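(* Let $d\ge1$, $M>0$. Let $X_1,\dots,X_n$ be i.i.d. from $P=(1-\epsilon)P_{f_\pi}+\epsilon Q$, where $\epsilon\in(0,1)$, $\pi$ is a probability measure with $\mathrm{supp}(\pi)\subseteq[-M,M]^d$, $P_{f_\pi}$ is the distribution with density $f_\pi$, and $Q$ is an arbitrary probability distribution on $\mathbb R^d$. Then $$\inf_{\widehat f}\sup_{\pi,Q}\mathbb E\big[H^2(f_\pi,\widehat f)\big]\gtrsim\epsilon^{2\left(1-\frac{0.33}{\log(\log(1/\epsilon)\vee e)}\right)},$$ where the infimum is over all estimators $\widehat f=\widehat f(X_1,\dots,X_n)$, the expectation is over $X_1,\dots,X_n$ drawn i.i.d. from $P=(1-\epsilon)P_{f_\pi}+\epsilon Q$, and the supremum is over all $Q$ and all $\pi$ with $\mathrm{supp}(\pi)\subseteq[-M,M]^d$.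
   Context: $f_\pi(x)=\int_{\mathbb R^d}\phi_d(x-\theta)\,d\pi(\theta)$ with $\phi_d$ the standard Gaussian density on $\mathbb R^d$. $H(p,q)=\sqrt{\frac12\int(\sqrt p-\sqrt q)^2}$. $a\vee b=\max\{a,b\}$. The notation $\gtrsim$ hides a positive multiplicative constant depending only on $M$ and $d$ (not on $\epsilon$ or $n$). *)

(* Defs.v *)
From HB Require Import structures.
From mathcomp Require Import all_boot all_order all_algebra.
From mathcomp Require Import all_classical all_reals all_analysis.
From mathcomp Require Import measurable_realfun normal_distribution ring.

Set Implicit Arguments.
Unset Strict Implicit.
Unset Printing Implicit Defensive.

Import Order.TTheory GRing.Theory Num.Theory.
Import numFieldNormedType.Exports.

Local Open Scope classical_set_scope.
Local Open Scope ring_scope.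

(* R^d is represented by [d.-tuple R], which carries the product
   sigma-algebra; the library has no Lebesgue measure or product measure on
   tuples, so both are built here by induction on the length. *)

Section tuple_cons.
Context d (T : measurableType d) (n : nat).

Definition tcons (p : T * n.-tuple T) : n.+1.-tuple T := [tuple of p.1 :: p.2].

Lemma measurable_tcons : measurable_fun setT tcons.
Proof. exact: measurable_cons. Qed.

HB.instance Definition _ := isMeasurableFun.Build _ _ _ _ _ measurable_tcons.

Definition tuncons (t : n.+1.-tuple T) : T * n.-tuple T :=
  (thead t, [tuple of behead t]).

Lemma measurable_tuncons : measurable_fun setT tuncons.
Proof.
apply/measurable_fun_pairP; split; first exact: measurable_tnth.
exact: measurable_behead.
Qed.

Lemma tconsK : cancel tcons tuncons.
Proof. by case=> x t; congr pair; apply/val_inj. Qed.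

Lemma tunconsK : cancel tuncons tcons.
Proof. by move=> t; rewrite [RHS]tuple_eta. Qed.

End tuple_cons.

Section tuple_measure.
Local Open Scope ereal_scope.
Context d (T : measurableType d) (R : realType).

Section cons_measure.
Variables (n : nat) (m1 : {sigma_finite_measure set T -> \bar R}).
Variable m2 : {sigma_finite_measure set (n.-tuple T) -> \bar R}.

Definition cons_measure : set (n.+1.-tuple T) -> \bar R :=
  pushforward (m1 \x m2) (@tcons _ T n).

Let cons_measure0 : cons_measure set0 = 0.
Proof. by rewrite /cons_measure /pushforward preimage_set0 measure0. Qed.

Let cons_measure_ge0 A : 0 <= cons_measure A.
Proof. exact: measure_ge0. Qed.

Let cons_measure_sigma_additive : semi_sigma_additive cons_measure.
Proof.
exact: measure_semi_sigma_additive.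
Qed.

HB.instance Definition _ := isMeasure.Build _ _ _
  cons_measure cons_measure0 cons_measure_ge0 cons_measure_sigma_additive.

Let cons_measure_sigma_finite : sigma_finite setT cons_measure.
Proof.
have /sigma_finiteP[F [TF ndF Foo]] := sigma_finiteT m1.
have /sigma_finiteP[G [TG ndG Goo]] := sigma_finiteT m2.
exists (fun k => @tuncons _ T n @^-1` (F k `*` G k)).
  apply/esym; rewrite -subTset => t _ /=.
  have [i _ Fi] : (\bigcup_k F k) (tuncons t).1 by rewrite -TF.
  have [j _ Gj] : (\bigcup_k G k) (tuncons t).2 by rewrite -TG.
  exists (maxn i j) => //; split.
  - by move: Fi; exact/subsetPset/ndF/leq_maxl.
  - by move: Gj; exact/subsetPset/ndG/leq_maxr.
move=> k; have [mF Fk] := Foo k; have [mG Gk] := Goo k.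
have mFG : measurable (F k `*` G k) by exact: measurableX.
split; first by rewrite -[X in measurable X]setTI; exact: measurable_tuncons.
rewrite /cons_measure /pushforward (_ : _ @^-1` _ = F k `*` G k); last first.
  by apply/funext => p; rewrite /preimage /mkset tconsK.
by rewrite product_measure1E// lte_mul_pinfty// ge0_fin_numE.
Qed.

HB.instance Definition _ := Measure_isSigmaFinite.Build _ _ _
  cons_measure cons_measure_sigma_finite.

End cons_measure.

Fixpoint tuple_measure (m : {sigma_finite_measure set T -> \bar R}) n :
    {sigma_finite_measure set (n.-tuple T) -> \bar R} :=
  match n with
  | 0 => dirac [tuple]
  | k.+1 => cons_measure m (tuple_measure m k)
  end.

Fixpoint iid (P : probability T R) n : probability (n.-tuple T) R :=
  match n with
  | 0 => dirac [tuple]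
  | k.+1 => distribution (P \x iid P k) (@tcons _ T k)
  end.

End tuple_measure.


(* The library puts [lebesgue_measure] on [measurableTypeR R], whose display
   differs from that of the canonical measurableType on [R]. *)
Section lebesgue_real.
Context (R : realType).

Definition lebesgue_real : set R -> \bar R := @lebesgue_measure R.

Let lebesgue_real0 : lebesgue_real set0 = 0%E.
Proof. exact: (@measure0 _ _ _ (@lebesgue_measure R)). Qed.

Let lebesgue_real_ge0 A : (0 <= lebesgue_real A)%E.
Proof. exact: (@measure_ge0 _ _ _ (@lebesgue_measure R)). Qed.

Let lebesgue_real_sigma_additive : semi_sigma_additive lebesgue_real.
Proof. exact: (@measure_semi_sigma_additive _ _ _ (@lebesgue_measure R)). Qed.

HB.instance Definition _ := isMeasure.Build _ _ _ lebesgue_real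
  lebesgue_real0 lebesgue_real_ge0 lebesgue_real_sigma_additive.

Let lebesgue_real_sigma_finite : sigma_finite setT lebesgue_real.
Proof. exact: (@sigma_finiteT _ _ _ (@lebesgue_measure R)). Qed.

HB.instance Definition _ := Measure_isSigmaFinite.Build _ _ _
  lebesgue_real lebesgue_real_sigma_finite.

Lemma ge0_integral_lebesgue_real (f : R -> \bar R) :
  measurable_fun setT f -> (forall x, 0 <= f x)%E ->
  (\int[lebesgue_real]_x f x = \int[@lebesgue_measure R]_x f x)%E.
Proof.
move=> mf f0.
have mid : @measurable_fun _ _ (measurableTypeR R) R setT (fun x => x).
  exact: (@measurable_id _ R).
exact: (ge0_integral_pushforward mid (@lebesgue_measure R) measurableT mf).
Qed.

End lebesgue_real.

Definition lebesgue_tuple (R : realType) d :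
    {sigma_finite_measure set (d.-tuple R) -> \bar R} :=
  tuple_measure (@lebesgue_real R) d.

Definition tsub (R : realType) d (x y : d.-tuple R) : d.-tuple R :=
  [tuple tnth x i - tnth y i | i < d].

Definition enorm (R : realType) d (x : d.-tuple R) : R :=
  Num.sqrt (\sum_(i < d) tnth x i ^+ 2).

Definition gauss_pdf (R : realType) d (x : d.-tuple R) : R :=
  (2 * pi) `^ (- (d%:R / 2)) * expR (- (enorm x ^+ 2 / 2)).

Section gauss_pdf_theory.
Context (R : realType).

Lemma gauss_pdfE d (x : d.-tuple R) :
  gauss_pdf x = \prod_(i < d) normal_pdf 0 1 (tnth x i).
Proof.
rewrite /gauss_pdf normal_pdfE// /normal_peak /normal_fun big_split/=.
rewrite prodr_const card_ord sqr_sqrtr ?sumr_ge0// => [|i _]; last exact: sqr_ge0.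
congr (_ * _).
  rewrite expr1n mul1r -(mulr_natl pi) -powR12_sqrt; last first.
    by rewrite mulr_ge0// pi_ge0.
  rewrite -powRN -powR_mulrn ?powR_ge0// -powRrM.
  by congr (_ `^ _); field.
rewrite -expR_sum; congr expR; rewrite mulr_suml -sumrN.
by apply: eq_bigr => i _; rewrite subr0 expr1n mulNr.
Qed.

Lemma gauss_pdf_ge0 d (x : d.-tuple R) : 0 <= gauss_pdf x.
Proof. by rewrite /gauss_pdf mulr_ge0 ?powR_ge0 ?expR_ge0. Qed.

Lemma gauss_pdf_le d (x : d.-tuple R) :
  gauss_pdf x <= (2 * pi) `^ (- (d%:R / 2)).
Proof.
by rewrite /gauss_pdf ler_piMr ?powR_ge0// expR_le1 oppr_le0 divr_ge0 ?sqr_ge0.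
Qed.

Lemma gauss_pdf_tsubE d (x theta : d.-tuple R) : gauss_pdf (tsub x theta) =
  \prod_(i < d) normal_pdf (tnth theta i) 1 (tnth x i).
Proof.
rewrite gauss_pdfE; apply: eq_bigr => i _.
by rewrite !normal_pdfE// tnth_mktuple /normal_fun subr0.
Qed.

Lemma measurable_tsub d :
  measurable_fun setT (fun p : d.-tuple R * d.-tuple R => tsub p.1 p.2).
Proof.
apply/measurable_fun_tnthP => i.
rewrite (_ : _ \o _ = fun p : d.-tuple R * d.-tuple R =>
    tnth p.1 i - tnth p.2 i); last by apply/funext => p /=; rewrite tnth_mktuple.
apply: measurable_funB.
- exact: (measurableT_comp (measurable_tnth i) measurable_fst).
- exact: (measurableT_comp (measurable_tnth i) measurable_snd).
Qed.

Lemma measurable_gauss_pdf d : measurable_fun setT (@gauss_pdf R d).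
Proof.
rewrite (_ : @gauss_pdf R d =
  fun x => \prod_(i < d) normal_pdf 0 1 (tnth x i)); last first.
  by apply/funext => x; exact: gauss_pdfE.
apply: measurable_prod => i _.
exact: (measurableT_comp (measurable_normal_pdf 0 1) (measurable_tnth i)).
Qed.

Lemma integral_prod_tnth d (g : 'I_d -> R -> R) :
  (forall i, measurable_fun setT (g i)) -> (forall i x, 0 <= g i x) ->
  (forall i, \int[@lebesgue_real R]_x (g i x)%:E = 1)%E ->
  (\int[lebesgue_tuple R d]_x (\prod_(i < d) g i (tnth x i))%:E = 1)%E.
Proof.
elim: d => [|d IH] in g * => mg g0 g1.
  rewrite integral_dirac//= ?diracT ?mul1e ?big_ord0//.
  by apply/measurable_EFinP; apply: measurable_prod => -[].
have mG k (h : 'I_k -> R -> R) : (forall i, measurable_fun setT (h i)) ->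
    measurable_fun setT (fun x : k.-tuple R => (\prod_(i < k) h i (tnth x i))%:E).
  move=> mh; apply/measurable_EFinP; apply: measurable_prod => i _.
  exact: (measurableT_comp (mh i) (measurable_tnth i)).
rewrite /= /cons_measure ge0_integral_pushforward//=; last 2 first.
- exact: mG.
- by move=> x _; rewrite lee_fin prodr_ge0.
rewrite preimage_setT.
have mGc : measurable_fun setT
   ((fun x : d.+1.-tuple R => (\prod_(i < d.+1) g i (tnth x i))%:E) \o @tcons _ R d).
  exact: (measurableT_comp (mG _ _ mg) (@measurable_tcons _ R d)).
rewrite (fubini_tonelli1 _ mGc); last by move=> x /=; rewrite lee_fin prodr_ge0.
rewrite /fubini_F -[RHS](g1 ord0); apply: eq_integral => x _ /=.
under eq_integral.
  move=> t _; rewrite big_ord_recl tnth0.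
  under eq_bigr do rewrite tnthS.
  rewrite EFinM; over.
rewrite /= ge0_integralZl//.
- by rewrite (IH (fun i => g (lift ord0 i)))// mule1.
- by apply: (mG _ (fun i => g (lift ord0 i))).
- by move=> t _; rewrite lee_fin prodr_ge0.
- by rewrite lee_fin.
Qed.

Lemma integral_gauss_pdf_tsub d (theta : d.-tuple R) :
  (\int[lebesgue_tuple R d]_x (gauss_pdf (tsub x theta))%:E = 1)%E.
Proof.
under eq_integral do rewrite gauss_pdf_tsubE.
apply: (@integral_prod_tnth _ (fun i => normal_pdf (tnth theta i) 1)).
- by move=> i; exact: measurable_normal_pdf.
- by move=> i x; exact: normal_pdf_ge0.
- move=> i; rewrite ge0_integral_lebesgue_real ?integral_normal_pdf//.
    by apply/measurable_EFinP; exact: measurable_normal_pdf.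
  by move=> x; rewrite lee_fin normal_pdf_ge0.
Qed.

End gauss_pdf_theory.

(* The mixing measure is called [nu] because [pi] is the real number. *)
Section gauss_mixture.
Context (R : realType) (d : nat) (nu : probability (d.-tuple R) R).

Definition gauss_mix_pdf (x : d.-tuple R) : R :=
  \int[nu]_theta gauss_pdf (tsub x theta).

Lemma measurable_gauss_pdf_tsub : measurable_fun setT
  (fun p : d.-tuple R * d.-tuple R => (gauss_pdf (tsub p.1 p.2))%:E).
Proof.
apply/measurable_EFinP; apply: measurableT_comp; last exact: measurable_tsub.
exact: measurable_gauss_pdf.
Qed.

Lemma gauss_mix_pdfE x :
  ((gauss_mix_pdf x)%:E = \int[nu]_theta (gauss_pdf (tsub x theta))%:E)%E.
Proof.
rewrite /gauss_mix_pdf /Rintegral fineK// integrable_fin_num//.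
apply: measurable_bounded_integrable => //.
- exact: (le_lt_trans (probability_le1 nu measurableT) (ltry 1)).
- apply/measurable_EFinP.
  exact: (measurableT_comp measurable_gauss_pdf_tsub (@pair1_measurable _ _ _ _ x)).
- exists ((2 * pi) `^ (- (d%:R / 2))); split; first exact: num_real.
  move=> M /ltW ltM theta _ /=.
  by rewrite ger0_norm ?gauss_pdf_ge0// (le_trans (gauss_pdf_le _)).
Qed.

Lemma gauss_mix_pdf_ge0 x : 0 <= gauss_mix_pdf x.
Proof. by apply: Rintegral_ge0 => theta _; exact: gauss_pdf_ge0. Qed.

Lemma measurable_gauss_mix_pdf : measurable_fun setT gauss_mix_pdf.
Proof.
apply/measurable_EFinP; rewrite (_ : _ \o _ = fubini_F nu
    (fun p : d.-tuple R * d.-tuple R => (gauss_pdf (tsub p.1 p.2))%:E)); last first.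
  by apply/funext => x /=; rewrite gauss_mix_pdfE.
apply: measurable_fun_fubini_tonelli_F; first exact: measurable_gauss_pdf_tsub.
by move=> p; rewrite lee_fin gauss_pdf_ge0.
Qed.

Lemma integral_gauss_mix_pdf :
  (\int[lebesgue_tuple R d]_x (gauss_mix_pdf x)%:E = 1)%E.
Proof.
under eq_integral do rewrite gauss_mix_pdfE.
rewrite (fubini_tonelli _ measurable_gauss_pdf_tsub) => [|p]; last first.
  by rewrite lee_fin gauss_pdf_ge0.
under eq_integral do rewrite integral_gauss_pdf_tsub.
by rewrite integral_cst// mul1e; exact: (probability_setT nu).
Qed.

Definition gauss_mix : set (d.-tuple R) -> \bar R :=
  fun A => (\int[lebesgue_tuple R d]_(x in A) (gauss_mix_pdf x)%:E)%E.

Let gauss_mix0 : gauss_mix set0 = 0%E.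
Proof. exact: integral_set0. Qed.

Let gauss_mix_ge0 A : (0 <= gauss_mix A)%E.
Proof. by apply: integral_ge0 => x _; rewrite lee_fin gauss_mix_pdf_ge0. Qed.

Let gauss_mix_sigma_additive : semi_sigma_additive gauss_mix.
Proof.
move=> F mF tF mUF; rewrite /gauss_mix ge0_integral_bigcup//=; last 2 first.
- by apply/measurable_EFinP/measurable_funTS; exact: measurable_gauss_mix_pdf.
- by move=> x _; rewrite lee_fin gauss_mix_pdf_ge0.
apply: is_cvg_ereal_nneg_natsum_cond => n _ _.
by apply: integral_ge0 => x _; rewrite lee_fin gauss_mix_pdf_ge0.
Qed.

HB.instance Definition _ := isMeasure.Build _ _ _
  gauss_mix gauss_mix0 gauss_mix_ge0 gauss_mix_sigma_additive.

HB.instance Definition _ :=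
  Measure_isProbability.Build _ _ _ gauss_mix integral_gauss_mix_pdf.

End gauss_mixture.

Section contamination.
Context d (T : measurableType d) (R : realType).
Variables (eps : {i01 R}) (P Q : probability T R).

Definition contaminate : set T -> \bar R :=
  measure_add (mscale (1 - eps%:num)%:nng P) (mscale eps%:num%:nng Q).

HB.instance Definition _ := Measure.on contaminate.

Lemma contaminateE A :
  contaminate A = ((1 - eps%:num)%:E * P A + eps%:num%:E * Q A)%E.
Proof. by rewrite /contaminate measure_addE. Qed.

Let contaminate_setT : contaminate setT = 1%E.
Proof.
by rewrite contaminateE !probability_setT !mule1 -EFinD subrK.
Qed.

HB.instance Definition _ :=
  Measure_isProbability.Build _ _ _ contaminate contaminate_setT.

End contamination.

Section minimax.
Context (R : realType) (d : nat).
Implicit Types (M : R) (nu Q : probability (d.-tuple R) R).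

Definition msupport nu : set (d.-tuple R) :=
  [set x | forall r : R, 0 < r ->
    (0 < nu [set y | (enorm (tsub y x) < r)%R])%E].

Definition cube M : set (d.-tuple R) :=
  [set x | forall i, - M <= tnth x i <= M].

(* Extended-real valued, since an estimate need not be integrable. *)
Definition hellinger (p q : d.-tuple R -> R) : \bar R :=
  sqrte (2^-1%:E * \int[lebesgue_tuple R d]_x
                     ((Num.sqrt (p x) - Num.sqrt (q x)) ^+ 2)%:E)%E.

(* Estimates are nonnegative functions, not required to be densities; joint
   measurability in the sample and the point makes the loss measurable in the
   sample. *)
Definition estimator n (fhat : n.-tuple (d.-tuple R) -> d.-tuple R -> R) :=
  measurable_fun setT (fun p : n.-tuple (d.-tuple R) * d.-tuple R =>
    fhat p.1 p.2) /\
  forall X x, 0 <= fhat X x.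

Definition risk n (eps : {i01 R})
    (fhat : n.-tuple (d.-tuple R) -> d.-tuple R -> R) nu Q : \bar R :=
  (\int[iid (contaminate eps (gauss_mix nu) Q) n]_X
     hellinger (gauss_mix_pdf nu) (fhat X) ^+ 2)%E.

Definition worst_risk n M (eps : {i01 R})
    (fhat : n.-tuple (d.-tuple R) -> d.-tuple R -> R) : \bar R :=
  ereal_sup [set risk eps fhat nu Q |
    nu in [set nu | msupport nu `<=` cube M] & Q in setT].

Definition minimax_risk n M (eps : {i01 R}) : \bar R :=
  ereal_inf [set worst_risk M eps fhat | fhat in @estimator n].

End minimax.

(* Main.v *)
(** Le Cam's two-point method. Let [nu_s] put mass proportional to
    [(1 + s (-1)^j) C(k,j) exp(theta_j^2 / 2)] at [theta_j e_1], where
    [theta_j = a (k - 2 j)], [a = M / k] and [k] is odd. The factor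
    [exp(theta_j^2 / 2)] cancels the one in [phi(x - theta_j)], so by the
    binomial formula the mixture density is, up to a constant in
    [[exp(- M^2 / 2), 1]], equal to
    [phi_d(x) (cosh(a x_1)^k + s sinh(a x_1)^k)].

    Compare [s = t] and [s = - t]. The difference of the densities is about
    [t phi_d(x) (a x_1)^k]; it is dominated by [t tau_k] times a wider Gaussian
    density [psi], with [tau_k^2] close to [(M^2 / (e k))^k], so contamination
    at level [eps] hides it as soon as [t tau_k <= eps]. The squared Hellinger
    distance is about [t^2 E (a X)^(2k)], close to [t^2 (2 M^2 / (e k))^k]: the
    tails gain a factor close to [2^k] over [eps^2]. With [L = log(1 / eps)],
    [t = eps / tau_k] and [k] about [1.4 L / log L], this gain beats
    [exp(0.66 L / log L)]. *)

From HB Require Import structures.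
Require Import Defs.
From mathcomp Require Import all_boot all_order all_algebra.
From mathcomp Require Import all_classical all_reals all_analysis.
From mathcomp Require Import measurable_realfun normal_distribution ring lra.

Import Order.TTheory GRing.Theory Num.Theory.
Import numFieldNormedType.Exports.

Local Open Scope classical_set_scope.
Local Open Scope ring_scope.

(** * Sample laws, probabilities given by densities or atoms, and supports *)

(** The hypothesis covers measurable sets only, so the laws cannot be exchanged as functions; the
    induction compares the integrals of the measures of sections. *)
Lemma eq_iid d (T : measurableType d) (R : realType) (P P' : probability T R) :
  (forall A, measurable A -> P A = P' A) ->
  forall n A, measurable A -> iid P n A = iid P' n A.
Proof.
move=> PP'; elim=> [//|n IH] A mA /=.
rewrite /distribution /pushforward.
have mB : measurable (@tcons _ T n @^-1` A).
  by rewrite -[X in measurable X]setTI; exact: measurable_tcons.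
rewrite /= /product_measure1.
rewrite (eq_measure_integral P') => [|B mB' _]; last exact: PP'.
by apply: eq_integral => x _ /=; apply: IH; exact: measurable_xsection.
Qed.

Section density.
Context d (T : measurableType d) (R : realType) (mu : {measure set T -> \bar R}).
Variable f : T -> R.
Hypothesis mf : measurable_fun setT f.
Hypothesis f0 : forall x, 0 <= f x.
Hypothesis f1 : (\int[mu]_x (f x)%:E = 1)%E.

Let dens : set T -> \bar R := fun A => (\int[mu]_(x in A) (f x)%:E)%E.

Let dens0 : dens set0 = 0%E. Proof. exact: integral_set0. Qed.

Let dens_ge0 A : (0 <= dens A)%E.
Proof. by apply: integral_ge0 => x _; rewrite lee_fin f0. Qed.

Let dens_sigma_additive : semi_sigma_additive dens.
Proof.
move=> F mF tF mUF; rewrite /dens ge0_integral_bigcup//=; last 2 first.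
- by apply/measurable_EFinP/measurable_funTS.
- by move=> x _; rewrite lee_fin f0.
apply: is_cvg_ereal_nneg_natsum_cond => n _ _.
by apply: integral_ge0 => x _; rewrite lee_fin f0.
Qed.

HB.instance Definition _ := isMeasure.Build _ _ _
  dens dens0 dens_ge0 dens_sigma_additive.

HB.instance Definition _ := Measure_isProbability.Build _ _ _ dens f1.

Lemma probability_of_density : exists P : probability T R,
  forall A, P A = (\int[mu]_(x in A) (f x)%:E)%E.
Proof. by exists dens. Qed.

End density.

Section discrete.
Context d (T : measurableType d) (R : realType).
Variables (n : nat) (w : nat -> {nonneg R}) (c : nat -> T).
Hypothesis w1 : \sum_(j < n) (w j)%:num = 1.

Let disc : set T -> \bar R := msum (fun j => mscale (w j) (dirac (c j))) n.

HB.instance Definition _ := Measure.on disc.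

Let disc1 : disc setT = 1%E.
Proof.
rewrite /disc /msum -w1 -sumEFin; apply: eq_bigr => j _.
by rewrite /= /mscale/= diracT mule1.
Qed.

HB.instance Definition _ := Measure_isProbability.Build _ _ _ disc disc1.

(** The clause on null sets locates the support of the mixing measure; the clause on integrals turns
    a Gaussian mixture density into a finite sum. *)
Lemma probability_of_atoms : exists P : probability T R,
  (forall A, (forall j, ~ A (c j)) -> P A = 0%E) /\
  forall f : T -> \bar R, measurable_fun setT f -> (forall x, 0 <= f x)%E ->
  (\int[P]_x f x = \sum_(j < n) (w j)%:num%:E * f (c j))%E.
Proof.
exists disc; split=> [A Ac|f mf f0].
  rewrite /= /disc /msum big1// => j _.
  by rewrite /= /mscale/= diracE memNset ?mule0.
rewrite ge0_integral_measure_sum//; apply: eq_bigr => j _.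
by rewrite ge0_integral_mscale// integral_dirac// diracT mul1e.
Qed.

End discrete.

Lemma sub_enorm_tsub (R : realType) d (x y : d.-tuple R) i :
  `|tnth x i - tnth y i| <= enorm (tsub x y).
Proof.
rewrite /enorm -sqrtr_sqr ler_sqrt ?sumr_ge0// => [|j _]; last exact: sqr_ge0.
rewrite (bigD1 i)//= tnth_mktuple lerDl sumr_ge0// => j _; exact: sqr_ge0.
Qed.

(** If [|x_i| > M], the ball around [x] of radius [|x_i| - M] misses the cube and hence is null. *)
Lemma msupport_cube (R : realType) d (nu : probability (d.-tuple R) R) (M : R) :
  (forall A, A `&` cube M = set0 -> nu A = 0%E) -> msupport nu `<=` cube M.
Proof.
move=> nu0 x xs i; rewrite -ler_norml leNgt; apply/negP => Mx.
have r0 : 0 < `|tnth x i| - M by rewrite subr_gt0.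
have := xs _ r0; rewrite nu0 ?ltxx//.
apply/seteqP; split=> // y [/= yr /(_ i)]; rewrite -ler_norml => yM.
have := le_lt_trans (sub_enorm_tsub R d y x i) yr.
rewrite ltNge => /negP; apply.
rewrite distrC (le_trans _ (lerB_dist _ _))// lerB//.
Qed.

(** * Hellinger loss and the two-point reduction *)

Lemma measurable_sqrt (R : realType) : measurable_fun setT (@Num.sqrt R).
Proof. by apply: continuous_measurable_fun; exact: sqrt_continuous. Qed.

Section le_cam.
Context (R : realType) (d : nat).
Implicit Types p q : d.-tuple R -> R.

Lemma sqr_hellinger p q : (hellinger p q ^+ 2 =
  2^-1%:E * \int[lebesgue_tuple R d]_x
    ((Num.sqrt (p x) - Num.sqrt (q x)) ^+ 2)%:E)%E.
Proof.
rewrite /hellinger sqr_sqrte// mule_ge0//.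
by apply: integral_ge0 => x _; rewrite lee_fin sqr_ge0.
Qed.

Lemma sqr_hellinger_triangle (p0 p1 q : d.-tuple R -> R) :
  measurable_fun setT p0 -> measurable_fun setT p1 -> measurable_fun setT q ->
  (2^-1%:E * hellinger p0 p1 ^+ 2 <= hellinger p0 q ^+ 2 + hellinger p1 q ^+ 2)%E.
Proof.
move=> mp0 mp1 mq.
have md (f g : d.-tuple R -> R) : measurable_fun setT f -> measurable_fun setT g ->
    measurable_fun setT
      (fun x => ((Num.sqrt (f x) - Num.sqrt (g x)) ^+ 2)%:E).
  move=> mf mg; apply/measurable_EFinP; apply: measurable_funX.
  by apply: measurable_funB; apply: measurableT_comp => //; exact: measurable_sqrt.
have d0 (f g : d.-tuple R -> R) x :
    (0 <= ((Num.sqrt (f x) - Num.sqrt (g x)) ^+ 2)%:E)%E.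
  by rewrite lee_fin sqr_ge0.
rewrite !sqr_hellinger -ge0_muleDr; try by apply: integral_ge0.
rewrite -ge0_integralD//; try exact: md.
rewrite muleCA; apply: lee_wpmul2l; first by rewrite lee_fin invr_ge0.
rewrite -ge0_integralZl_EFin//; try exact: md.
apply: ge0_le_integral => //.
- by move=> x _; rewrite mule_ge0// lee_fin invr_ge0.
- by apply: emeasurable_funM => //; exact: md.
- by apply: emeasurable_funD; exact: md.
- move=> x _; rewrite -EFinM -EFinD lee_fin.
  (* Half of this square is the gap between the two sides. *)
  have := sqr_ge0 (Num.sqrt (p0 x) + Num.sqrt (p1 x) - 2 * Num.sqrt (q x)).
  by lra.
Qed.

Lemma measurable_sqr_hellinger n (fhat : n.-tuple (d.-tuple R) -> d.-tuple R -> R) p :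
  estimator fhat -> measurable_fun setT p ->
  measurable_fun setT (fun X => hellinger p (fhat X) ^+ 2)%E.
Proof.
move=> [mfhat _] mp.
under eq_fun do rewrite sqr_hellinger.
apply: emeasurable_funM => //.
apply: (@measurable_fun_fubini_tonelli_F _ _ _ _ _ (lebesgue_tuple R d)
  (fun Xx => ((Num.sqrt (p Xx.2) - Num.sqrt (fhat Xx.1 Xx.2)) ^+ 2)%:E)).
  apply/measurable_EFinP; apply: measurable_funX; apply: measurable_funB.
    apply: measurableT_comp; first exact: measurable_sqrt.
    exact: (measurableT_comp mp measurable_snd).
  by apply: measurableT_comp => //; exact: measurable_sqrt.
by move=> x; rewrite lee_fin sqr_ge0.
Qed.

(** Both pairs give the same sample law, so the two risks are integrals against one measure. By the
    triangle inequality they add up to at least [b / 2], and the worst risk is at least half of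
    that, whatever [n] is. *)
Lemma minimax_risk_two_points n (M : R) (eps : {i01 R})
    (nu0 nu1 Q0 Q1 : probability (d.-tuple R) R) (b : R) :
  msupport nu0 `<=` cube M -> msupport nu1 `<=` cube M ->
  (forall A, measurable A -> contaminate eps (gauss_mix nu0) Q0 A =
     contaminate eps (gauss_mix nu1) Q1 A) ->
  (b%:E <= hellinger (gauss_mix_pdf nu0) (gauss_mix_pdf nu1) ^+ 2)%E ->
  ((4^-1 * b)%:E <= minimax_risk d n M eps)%E.
Proof.
move=> s0 s1 PP bH; apply: le_ereal_inf_tmp => _ [fhat efhat <-].
have r0 : (risk eps fhat nu0 Q0 <= worst_risk M eps fhat)%E.
  by apply: ereal_sup_ubound; exists nu0 => //; exists Q0.
have r1 : (risk eps fhat nu1 Q1 <= worst_risk M eps fhat)%E.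
  by apply: ereal_sup_ubound; exists nu1 => //; exists Q1.
have H0 (nu : probability (d.-tuple R) R) X :
    (0 <= hellinger (gauss_mix_pdf nu) (fhat X) ^+ 2)%E.
  by rewrite sqr_hellinger mule_ge0 ?lee_fin ?invr_ge0// integral_ge0// => x _;
    rewrite lee_fin sqr_ge0.
have mH (nu : probability (d.-tuple R) R) : measurable_fun setT
    (fun X => hellinger (gauss_mix_pdf nu) (fhat X) ^+ 2)%E.
  by apply: measurable_sqr_hellinger => //; exact: measurable_gauss_mix_pdf.
have : ((2^-1 * b)%:E <= worst_risk M eps fhat + worst_risk M eps fhat)%E.
  apply: le_trans (leeD r0 r1); rewrite /risk.
  rewrite -(eq_measure_integral (iid (contaminate eps (gauss_mix nu0) Q0) n)
    (m1 := iid (contaminate eps (gauss_mix nu1) Q1) n)); last first.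
    by move=> A mA _; apply: eq_iid => // B mB; apply/esym/PP.
  rewrite -ge0_integralD//.
  rewrite -[leLHS]mule1 -(probability_setT (iid (contaminate eps (gauss_mix nu1) Q1) n)).
  have bH' X : ((2^-1 * b)%:E <= hellinger (gauss_mix_pdf nu0) (fhat X) ^+ 2 +
       hellinger (gauss_mix_pdf nu1) (fhat X) ^+ 2)%E.
    have mfX : measurable_fun setT (fhat X).
      by case: efhat => mf _; exact: (measurableT_comp mf (@pair1_measurable _ _ _ _ X)).
    apply: le_trans (sqr_hellinger_triangle _ _ _ _ _ mfX); try exact: measurable_gauss_mix_pdf.
    by rewrite EFinM lee_wpmul2l// lee_fin invr_ge0.
  have [b0|b0] := leP 0 b; last first.
    apply: (@le_trans _ _ 0%E).
      by rewrite probability_setT mule1 lee_fin pmulr_rle0 ?invr_gt0// ltW.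
    by apply: integral_ge0 => X _; rewrite adde_ge0.
  rewrite -integral_cst//; apply: ge0_le_integral => //.
  - by move=> X _; rewrite lee_fin mulr_ge0// invr_ge0.
  - by apply: emeasurable_funD; exact: mH.
case: (worst_risk M eps fhat) => [w| |] //=; last by move=> _; rewrite leey.
by rewrite -EFinD !lee_fin; lra.
Qed.

End le_cam.

(** * Elementary bounds on cosh and sinh *)

Section hyperbolic.
Context {R : realType}.
Implicit Types u x : R.

Definition hcosh u := (expR u + expR (- u)) / 2.
Definition hsinh u := (expR u - expR (- u)) / 2.

Lemma hsinhN u : hsinh (- u) = - hsinh u.
Proof. by rewrite /hsinh opprK; lra. Qed.

Lemma hcosh_gt0 u : 0 < hcosh u.
Proof. by rewrite divr_gt0// addr_gt0 ?expR_gt0. Qed.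

Lemma hcosh_le u : hcosh u <= expR `|u|.
Proof.
have h1 : expR u <= expR `|u| by rewrite ler_expR ler_norm.
have h2 : expR (- u) <= expR `|u| by rewrite ler_expR -normrN ler_norm.
by rewrite /hcosh; lra.
Qed.

Lemma norm_hsinhE u : `|hsinh u| = hsinh `|u|.
Proof.
wlog u0 : u / 0 <= u => [hw|].
  have [/hw//|u0] := leP 0 u.
  by rewrite -normrN -hsinhN hw ?normrN// oppr_ge0 ltW.
rewrite (ger0_norm u0) ger0_norm// /hsinh divr_ge0// subr_ge0 ler_expR; lra.
Qed.

(** This is [1 + z <= exp z] at [z = - 2 |u|], and the next bound is the case [z = 2 |u|]. The loss
    is affordable: for [u = a x] with [a k = M], the factor [exp |u|] grows only to [exp(M |x|)] in
    the [k]-th power. *)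
Lemma norm_hsinh_le u : `|hsinh u| <= `|u| * expR `|u|.
Proof.
rewrite norm_hsinhE; move: (normr_ge0 u); set v := `|u| => v0.
have h : expR v * (1 - 2 * v) <= expR (- v).
  rewrite -[X in _ <= expR X](_ : v + - (2 * v) = - v); last by ring.
  by rewrite expRD ler_wpM2l ?expR_ge0// expR_ge1Dx.
by rewrite /hsinh; lra.
Qed.

Lemma norm_hsinh_ge u : `|u| * expR (- `|u|) <= `|hsinh u|.
Proof.
rewrite norm_hsinhE; move: (normr_ge0 u); set v := `|u| => v0.
have h : expR (- v) * (1 + 2 * v) <= expR v.
  rewrite -[X in _ <= expR X](_ : - v + 2 * v = v); last by ring.
  by rewrite expRD ler_wpM2l ?expR_ge0// expR_ge1Dx.
by rewrite /hsinh; lra.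
Qed.

End hyperbolic.

(** * Product densities that are Gaussian off the first coordinate *)

Section tail_pdf.
Context {R : realType} {d : nat}.
Implicit Type x : d.+1.-tuple R.

(** The atoms lie on the first axis, so this factor is common to both mixture densities and to the
    envelope. *)
Definition tail_pdf x : R := \prod_(i < d) normal_pdf 0 1 (tnth x (lift ord0 i)).

Lemma tail_pdf_ge0 x : 0 <= tail_pdf x.
Proof. by apply: prodr_ge0 => i _; exact: normal_pdf_ge0. Qed.

Lemma measurable_tail_pdf : measurable_fun setT tail_pdf.
Proof.
apply: measurable_prod => i _.
exact: (measurableT_comp (measurable_normal_pdf 0 1) (measurable_tnth _)).
Qed.

(** Applied to the wider Gaussian density of the envelope and to the indicator of an interval of
    length one. *)
Lemma integral_tail_pdf (g : R -> R) : measurable_fun setT g ->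
  (forall y, 0 <= g y) -> (\int[@lebesgue_real R]_y (g y)%:E = 1)%E ->
  (\int[lebesgue_tuple R d.+1]_x (tail_pdf x * g (tnth x ord0))%:E = 1)%E.
Proof.
move=> mg g0 g1.
pose h (i : 'I_d.+1) := if i == ord0 then g else normal_pdf 0 1.
rewrite -[RHS](@integral_prod_tnth R d.+1 h).
- apply: eq_integral => x _; rewrite big_ord_recl /h/= mulrC.
  by congr (_ * _)%:E; apply: eq_bigr.
- by rewrite /h => i; case: ifP => // _; exact: measurable_normal_pdf.
- by rewrite /h => i y; case: ifP => // _; exact: normal_pdf_ge0.
- rewrite /h => i; case: ifP => // _.
  rewrite ge0_integral_lebesgue_real ?integral_normal_pdf//.
    by apply/measurable_EFinP; exact: measurable_normal_pdf.
  by move=> y; rewrite lee_fin normal_pdf_ge0.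
Qed.

End tail_pdf.

(** * The binomially weighted mixtures *)

Section binomial_mixture.
Context (R : realType) (M : R) (k : nat).
Hypothesis M0 : 0 < M.
Hypothesis kodd : odd k.

Let k0 : (0 < k)%N. Proof. by case: k kodd. Qed.
Let kR0 : 0 < k%:R :> R. Proof. by rewrite ltr0n. Qed.

Let a : R := M / k%:R.

Let ak : a * k%:R = M. Proof. by rewrite /a divfK// gt_eqF. Qed.
Let a0 : 0 < a. Proof. by rewrite divr_gt0. Qed.

Let loc (j : nat) : R := a * (k%:R - j%:R * 2).

Let wt (j : nat) : R := 'C(k, j)%:R * expR (loc j ^+ 2 / 2).

Let Z : R := \sum_(j < k.+1) wt j.

Let wt_ge0 j : 0 <= wt j. Proof. by rewrite mulr_ge0 ?expR_ge0. Qed.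

Let norm_loc (j : 'I_k.+1) : `|loc j| <= M.
Proof.
rewrite normrM (ger0_norm (ltW a0)) -[leRHS]ak ler_wpM2l ?(ltW a0)// ler_norml.
have : j%:R <= k%:R :> R by rewrite ler_nat -ltnS.
have : 0 <= j%:R :> R by [].
by lra.
Qed.

Let sum_bin : \sum_(j < k.+1) 'C(k, j)%:R = 2 ^+ k :> R.
Proof.
rewrite -[2]/(1 + 1) exprDn; apply: eq_bigr => i _.
by rewrite !expr1n mulr1.
Qed.

Let Z_ge : 2 ^+ k <= Z.
Proof.
rewrite -sum_bin; apply: ler_sum => j _; rewrite ler_peMr//.
by rewrite -expR0 ler_expR divr_ge0// sqr_ge0.
Qed.

Let Z_le : Z <= 2 ^+ k * expR (M ^+ 2 / 2).
Proof.
rewrite -sum_bin mulr_suml; apply: ler_sum => j _; rewrite ler_wpM2l//.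
rewrite ler_expR ler_wpM2r// -(real_normK (num_real (loc j))).
by rewrite lerXn2r ?nnegrE// ltW.
Qed.

Let Z0 : 0 < Z. Proof. by apply: lt_le_trans Z_ge; rewrite exprn_gt0. Qed.

(** Makes the normalizing constant [Z] the same for all [s]. The reflection of [j] to [k - j]
    preserves [wt] and, [k] being odd, flips the sign, so the sum is its own opposite. *)
Let alt_sum : \sum_(j < k.+1) (-1) ^+ j * wt j = 0.
Proof.
suff : \sum_(j < k.+1) (-1) ^+ j * wt j = - \sum_(j < k.+1) (-1) ^+ j * wt j.
  by lra.
rewrite [LHS](reindex_inj rev_ord_inj) -sumrN; apply: eq_bigr => j _ /=.
have jk : (j <= k)%N by rewrite -ltnS.
rewrite subSS /wt bin_sub//.
have -> : loc (k - j) = - loc j by rewrite /loc natrB//; ring.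
rewrite sqrrN -mulNr; congr (_ * _).
by rewrite -signr_odd oddB// kodd -[in RHS]signr_odd; case: odd; rewrite ?opprK.
Qed.

Let weight (s : R) j : R := (1 + s * (-1) ^+ j) * wt j / Z.

Let weight_ge0 s j : `|s| <= 1 -> 0 <= weight s j.
Proof.
move=> s1; rewrite divr_ge0 ?(ltW Z0)// mulr_ge0//.
have : `|s * (-1) ^+ j| <= 1 by rewrite normrM normr_sign mulr1.
by rewrite ler_norml; lra.
Qed.

Let sum_weight s : \sum_(j < k.+1) weight s j = 1.
Proof.
rewrite -mulr_suml.
under eq_bigr do rewrite mulrDl mul1r -mulrA.
by rewrite big_split/= -mulr_sumr alt_sum mulr0 addr0 divff// gt_eqF.
Qed.

Let normal_pdf_shift c x :
  normal_pdf c 1 x = normal_pdf 0 1 x * (expR (c * x) * expR (- (c ^+ 2 / 2))) :> R.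
Proof.
rewrite !normal_pdfE// /normal_fun -mulrA; congr (_ * _).
by rewrite -!expRD; congr expR; rewrite subr0; field.
Qed.

Let mixture1E s x : \sum_(j < k.+1) weight s j * normal_pdf (loc j) 1 x =
  normal_pdf 0 1 x * (2 ^+ k / Z) * (hcosh (a * x) ^+ k + s * hsinh (a * x) ^+ k).
Proof.
have -> : hcosh (a * x) ^+ k + s * hsinh (a * x) ^+ k =
    (2 ^+ k)^-1 * ((expR (a * x) + expR (- (a * x))) ^+ k +
            s * (expR (a * x) - expR (- (a * x))) ^+ k).
  by rewrite /hcosh /hsinh !exprMn !exprVn; ring.
have k2 : (2 : R) ^+ k != 0 by rewrite expf_neq0.
have -> (u : R) : normal_pdf 0 1 x * (2 ^+ k / Z) * ((2 ^+ k)^-1 * u) =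
    normal_pdf 0 1 x / Z * u.
  by field; rewrite k2 gt_eqF.
rewrite exprDn exprBn mulr_sumr -big_split mulr_sumr; apply: eq_bigr => j _ /=.
rewrite normal_pdf_shift /weight /wt.
have jk : (j <= k)%N by rewrite -ltnS.
(* The [j]-th binomial term has exponent [a x (k - 2 j)], which is [loc j] times [x]. *)
have -> : expR (a * x) ^+ (k - j) * expR (- (a * x)) ^+ j = expR (loc j * x).
  by rewrite -!expRM_natl -expRD natrB//; congr expR; rewrite /loc; ring.
rewrite -(mulrA ((-1) ^+ j)).
have -> : expR (a * x) ^+ (k - j) * expR (- (a * x)) ^+ j = expR (loc j * x).
  by rewrite -!expRM_natl -expRD natrB//; congr expR; rewrite /loc; ring.
rewrite -[X in _ = _ * (X + _)]mulr_natr -[X in _ = _ * (_ + _ * X)]mulr_natr.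
(* The factor built into [wt] cancels the one left by shifting the Gaussian. *)
have e1 : expR (loc j ^+ 2 / 2) * expR (- (loc j ^+ 2 / 2)) = 1.
  by rewrite -expRD subrr expR0.
transitivity ((1 + s * (-1) ^+ j) * 'C(k, j)%:R / Z * normal_pdf 0 1 x *
  expR (loc j * x) * (expR (loc j ^+ 2 / 2) * expR (- (loc j ^+ 2 / 2)))).
  by ring.
by rewrite e1; ring.
Qed.

Context (d : nat).
Implicit Type x : d.+1.-tuple R.

Let core x := tail_pdf x * normal_pdf 0 1 (tnth x ord0) * (2 ^+ k / Z).

Let atom (c : R) : d.+1.-tuple R := [tuple if i == ord0 then c else 0 | i < d.+1].

Let mixture_exists s : `|s| <= 1 -> exists nu : probability (d.+1.-tuple R) R,
  msupport nu `<=` cube M /\ forall x, gauss_mix_pdf nu x =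
    core x * (hcosh (a * tnth x ord0) ^+ k + s * hsinh (a * tnth x ord0) ^+ k).
Proof.
move=> s1.
pose w j : {nonneg R} := NngNum (weight_ge0 s j s1).
have sumw : \sum_(j < k.+1) (w j)%:num = 1 by exact: sum_weight.
(* Only indices up to [k] carry mass, but the clause on null sets speaks of all atoms; capping the
   index keeps every atom in the cube. *)
have [nu [nuA nuI]] :=
  probability_of_atoms _ _ _ _ _ (fun j => atom (loc (minn j k))) sumw.
exists nu; split.
  apply: msupport_cube => A AM; apply: nuA => j Aj.
  have : (A `&` cube M) (atom (loc (minn j k))).
    split=> // i; rewrite tnth_mktuple -ler_norml; case: ifP => _; last first.
      by rewrite normr0 ltW.
    have jk : (minn j k < k.+1)%N by rewrite ltnS geq_minr.
    exact: (norm_loc (Ordinal jk)).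
  by rewrite AM.
move=> x; apply: EFin_inj; rewrite gauss_mix_pdfE nuI; last 2 first.
- apply: (measurableT_comp (@measurable_gauss_pdf_tsub R d.+1) (@pair1_measurable _ _ _ _ x)).
- by move=> y; rewrite lee_fin gauss_pdf_ge0.
under eq_bigr do rewrite -EFinM.
rewrite sumEFin; congr EFin.
rewrite /core -2!(mulrA (tail_pdf x)) -mixture1E mulr_sumr.
apply: eq_bigr => j _ /=.
rewrite gauss_pdf_tsubE big_ord_recl tnth_mktuple eqxx.
have /minn_idPl -> : (j <= k)%N by rewrite -ltnS.
rewrite [RHS]mulrCA; congr (_ * _); rewrite [RHS]mulrC; congr (_ * _).
by apply: eq_bigr => i _; rewrite tnth_mktuple.
Qed.

(** The constant [c] is chosen before [s]. For [s = t] and [s = - t], the cosh terms then cancel in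
    the difference of the densities and the sinh terms in the sum. *)
Lemma binomial_mixtures : exists c : R, [/\ expR (- (M ^+ 2 / 2)) <= c, c <= 1 &
  forall s, `|s| <= 1 -> exists nu : probability (d.+1.-tuple R) R,
    msupport nu `<=` cube M /\ forall x, gauss_mix_pdf nu x =
      tail_pdf x * normal_pdf 0 1 (tnth x ord0) * c *
      (hcosh (M / k%:R * tnth x ord0) ^+ k + s * hsinh (M / k%:R * tnth x ord0) ^+ k)].
Proof.
exists (2 ^+ k / Z); split; last exact: mixture_exists.
- by rewrite ler_pdivlMr// expRN mulrC ler_pdivrMr ?expR_gt0.
- by rewrite ler_pdivrMr// mul1r.
Qed.

End binomial_mixture.

(** * Gaussian envelope and lower bound in one coordinate *)

Section one_dimensional_bounds.
Context {R : realType}.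
Variables (M a : R) (k : nat).
Hypothesis M0 : 0 < M.
Hypothesis k0 : (0 < k)%N.
Hypothesis aE : a = M / k%:R.

Let kR0 : 0 < k%:R :> R. Proof. by rewrite ltr0n. Qed.
Let ak : a * k%:R = M. Proof. by rewrite aE divfK// gt_eqF. Qed.
Let a0 : 0 < a. Proof. by rewrite aE divr_gt0. Qed.

(* The maximum over [x] of [((a x)^k exp(- 29 x^2 / 64))^2]. The exponent
   [x^2 / 2] is split as [29 x^2 / 64], [x^2 / 32] for the N(0, 16) envelope and
   [x^2 / 64] to absorb [exp(M |x|)]. *)
Definition upper_rate : R := (32 * M ^+ 2 / (29 * k%:R) * expR (- 1)) ^+ k.

Lemma upper_rate_gt0 : 0 < upper_rate.
Proof.
by rewrite exprn_gt0// mulr_gt0 ?expR_gt0// divr_gt0// ?mulr_gt0// exprn_gt0.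
Qed.

Let normal_pdf01 x : normal_pdf 0 1 x = normal_peak 1 * expR (- (x ^+ 2 / 2)) :> R.
Proof.
rewrite normal_pdfE// /normal_fun; congr (_ * expR _).
by rewrite subr0; field.
Qed.

Let normal_pdf04 x :
  normal_pdf 0 4 x = 4^-1 * normal_peak 1 * expR (- (x ^+ 2 / 32)) :> R.
Proof.
rewrite normal_pdfE// /normal_fun subr0; congr (_ * expR _); last by field.
rewrite /normal_peak -invfM; congr (_^-1).
have -> : 4 ^+ 2 * pi *+ 2 = 4 ^+ 2 * (1 ^+ 2 * pi *+ 2) :> R by ring.
by rewrite sqrtrM ?sqr_ge0// sqrtr_sqr ger0_norm.
Qed.

(** The envelope is N(0, 16); the factor 4 is the ratio of the peaks of N(0, 1) and N(0, 16). *)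
Lemma normal_pdf_hsinh_le x :
  normal_pdf 0 1 x * `|hsinh (a * x)| ^+ k <=
  4 * expR (16 * M ^+ 2) * Num.sqrt upper_rate * normal_pdf 0 4 x.
Proof.
have p0 := @normal_peak_ge0 R 1.
rewrite normal_pdf01 normal_pdf04.
set v := `|x|.
have v0 : 0 <= v by exact: normr_ge0.
have sh : `|hsinh (a * x)| ^+ k <= (a * v) ^+ k * expR (M * v).
  apply: (@le_trans _ _ ((a * v * expR (a * v)) ^+ k)).
    rewrite lerXn2r ?nnegrE ?mulr_ge0 ?expR_ge0 ?(ltW a0)//.
    suff <- : `|a * x| = a * v by exact: norm_hsinh_le.
    by rewrite normrM (ger0_norm (ltW a0)).
  by rewrite exprMn -expRM_natl mulrA (mulrC k%:R) ak.
have key : (a * v) ^+ k * expR (- (29 / 64 * v ^+ 2)) <= Num.sqrt upper_rate.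
  rewrite -[leLHS]ger0_norm ?mulr_ge0 ?exprn_ge0 ?expR_ge0 ?mulr_ge0 ?(ltW a0)//.
  rewrite -sqrtr_sqr ler_sqrt ?(ltW upper_rate_gt0)//.
  (* In this variable the square is the [k]-th power of a multiple of [u exp(- u)], which is at most
     [exp(- 1)]. *)
  pose u := 29 * v ^+ 2 / (32 * k%:R).
  have -> : ((a * v) ^+ k * expR (- (29 / 64 * v ^+ 2))) ^+ 2 =
     ((a * v) ^+ 2 * expR (- u)) ^+ k.
    rewrite exprMn -!exprM mulnC [RHS]exprMn -exprM -!expRM_natl; congr (_ * expR _).
    by rewrite /u; field; rewrite gt_eqF.
  rewrite /upper_rate lerXn2r ?nnegrE ?mulr_ge0 ?expR_ge0 ?sqr_ge0
    ?divr_ge0 ?mulr_ge0 ?sqr_ge0 ?(ltW kR0) ?(ltW a0) ?(ltW M0)//.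
  have -> : (a * v) ^+ 2 = 32 * M ^+ 2 / (29 * k%:R) * u.
    by rewrite /u aE; field; rewrite gt_eqF.
  rewrite -mulrA ler_wpM2l ?divr_ge0 ?mulr_ge0 ?sqr_ge0 ?(ltW kR0) ?(ltW a0) ?(ltW M0)//.
  rewrite -ler_pdivlMr ?expR_gt0// -expRN -expRD opprK.
  by have := expR_ge1Dx (- 1 + u); lra.
have -> : x ^+ 2 = v ^+ 2 by rewrite real_normK// num_real.
have expo : expR (- (v ^+ 2 / 2)) * expR (M * v) <=
    expR (16 * M ^+ 2) * expR (- (29 / 64 * v ^+ 2)) * expR (- (v ^+ 2 / 32)).
  rewrite -!expRD ler_expR.
  (* This square equals [16 M^2 - M v + v^2 / 64]. *)
  by have := sqr_ge0 (4 * M - v / 8); lra.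
apply: (@le_trans _ _ (normal_peak 1 * ((a * v) ^+ k * (expR (- (v ^+ 2 / 2)) * expR (M * v))))).
  by rewrite -(mulrA (normal_peak 1)) ler_wpM2l// [leRHS]mulrCA ler_wpM2l ?expR_ge0.
rewrite [leRHS](_ : _ = normal_peak 1 * (Num.sqrt upper_rate *
   (expR (16 * M ^+ 2) * expR (- (v ^+ 2 / 32))))); last by field.
rewrite ler_wpM2l//.
apply: (@le_trans _ _ ((a * v) ^+ k * (expR (16 * M ^+ 2) *
   expR (- (29 / 64 * v ^+ 2)) * expR (- (v ^+ 2 / 32))))).
  by rewrite ler_wpM2l// exprn_ge0// mulr_ge0// ltW.
rewrite [leLHS](_ : _ = ((a * v) ^+ k * expR (- (29 / 64 * v ^+ 2))) *
   (expR (16 * M ^+ 2) * expR (- (v ^+ 2 / 32)))); last by ring.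
by rewrite ler_wpM2r// mulr_ge0// expR_ge0.
Qed.

(** The maximum of [(a x)^(2 k) exp(- x^2 / 2)] is [(2 M^2 / (e k))^k], reached at [x^2 = 2 k]. The
    other exponents bound what is lost up to [x = sqrt(2 k) + 1]: the decay of the Gaussian past its
    maximum, [2 M x] from the squared sinh and [M x] from the cosh. *)
Definition lower_rate : R := normal_peak 1 * expR (- (2^-1 + 3 * M)) *
  ((2 * M ^+ 2 / k%:R * expR (- 1)) ^+ k *
   expR (- ((3 * M + 1) * Num.sqrt (2 * k%:R)))).

Lemma lower_rate_gt0 : 0 < lower_rate.
Proof.
rewrite /lower_rate !mulr_gt0 ?expR_gt0 ?normal_peak_gt0 ?oner_neq0//.
by rewrite exprn_gt0// mulr_gt0 ?expR_gt0// divr_gt0// mulr_gt0// exprn_gt0.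
Qed.

Lemma normal_pdf_hsinh_ge x :
  Num.sqrt (2 * k%:R) <= x <= Num.sqrt (2 * k%:R) + 1 ->
  lower_rate <= normal_pdf 0 1 x * (hsinh (a * x) ^+ k) ^+ 2 / hcosh (a * x) ^+ k.
Proof.
set r := Num.sqrt _ => /andP[rx xr].
have r0 : 0 <= r by exact: sqrtr_ge0.
have r2 : r ^+ 2 = 2 * k%:R by rewrite sqr_sqrtr// mulr_ge0// ltW.
have x0 : 0 <= x by exact: le_trans rx.
have x2 : 2 * k%:R <= x ^+ 2 by rewrite -r2 lerXn2r ?nnegrE.
have ax0 : 0 <= a * x by rewrite mulr_ge0// ltW.
have sh : (a ^+ 2 * (2 * k%:R)) ^+ k * expR (- (2 * M * x)) <= (hsinh (a * x) ^+ k) ^+ 2.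
  rewrite -exprM mulnC exprM.
  have -> : expR (- (2 * M * x)) = (expR (- (a * x)) ^+ 2) ^+ k.
    rewrite -!expRM_natl; congr expR; rewrite -[in LHS]ak; ring.
  rewrite -exprMn lerXn2r ?nnegrE ?sqr_ge0//.
    by rewrite !mulr_ge0 ?sqr_ge0 ?(ltW a0).
  apply: (@le_trans _ _ ((a * x * expR (- (a * x))) ^+ 2)).
    by rewrite [leRHS]exprMn ler_wpM2r ?sqr_ge0// [leRHS]exprMn ler_wpM2l// sqr_ge0.
  rewrite -[leRHS]real_normK ?num_real//.
  rewrite lerXn2r ?nnegrE//; first by rewrite mulr_ge0 ?expR_ge0.
  by have := norm_hsinh_ge (a * x); rewrite (ger0_norm ax0).
have ch : hcosh (a * x) ^+ k <= expR (M * x).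
  have -> : expR (M * x) = expR (a * x) ^+ k.
    by rewrite -expRM_natl; congr expR; rewrite -[in LHS]ak; ring.
  rewrite lerXn2r ?nnegrE ?expR_ge0 ?(ltW (hcosh_gt0 _))//.
  by have := hcosh_le (a * x); rewrite (ger0_norm ax0).
have c0 : 0 < hcosh (a * x) ^+ k by rewrite exprn_gt0// hcosh_gt0.
rewrite ler_pdivlMr// normal_pdf01.
have s0 : 0 <= (a ^+ 2 * (2 * k%:R)) ^+ k by rewrite exprn_ge0 ?mulr_ge0 ?sqr_ge0 ?(ltW a0).
apply: (@le_trans _ _ (normal_peak 1 * (expR (- (x ^+ 2 / 2)) *
    ((a ^+ 2 * (2 * k%:R)) ^+ k * expR (- (2 * M * x)))))); last first.
  by rewrite -[leRHS]mulrA ler_wpM2l ?normal_peak_ge0// ler_wpM2l ?expR_ge0.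
apply: (@le_trans _ _ (lower_rate * expR (M * x))).
  by rewrite ler_wpM2l// ltW// lower_rate_gt0.
have -> : a ^+ 2 * (2 * k%:R) = 2 * M ^+ 2 / k%:R.
  by rewrite aE; field; rewrite gt_eqF.
rewrite /lower_rate -/r exprMn -expRM_natl.
set B := (2 * M ^+ 2 / k%:R) ^+ k.
have B0 : 0 <= B by rewrite exprn_ge0// divr_ge0 ?(ltW kR0)// mulr_ge0// sqr_ge0.
rewrite [leLHS](_ : _ = normal_peak 1 * (B * (expR (- (2^-1 + 3 * M)) * expR (k%:R * - 1) *
   expR (- ((3 * M + 1) * r)) * expR (M * x)))); last by ring.
rewrite [leRHS](_ : _ = normal_peak 1 *
  (B * (expR (- (x ^+ 2 / 2)) * expR (- (2 * M * x))))); last by ring.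
rewrite ler_wpM2l ?normal_peak_ge0// ler_wpM2l// -!expRD ler_expR.
have x2' : x ^+ 2 <= (r + 1) ^+ 2 by rewrite lerXn2r ?nnegrE// addr_ge0.
have Mx : M * x <= M * (r + 1) by rewrite ler_wpM2l// ltW.
by rewrite sqrrD r2 in x2'; lra.
Qed.

End one_dimensional_bounds.

(** * Hiding the difference by contamination, and the bound at fixed [k] and [t] *)

(* With [f0], [f1] the mixture densities, take [Q0], [Q1] with densities
   [psi + c (f1 - f0)] and [psi + c (f0 - f1)], [c = (1 - eps) / (2 eps)]. *)
Lemma contaminations_agree (R : realType) d (eps : {i01 R})
    (nu0 nu1 : probability (d.-tuple R) R) (psi : d.-tuple R -> R) :
  0 < eps%:num -> measurable_fun setT psi ->
  (\int[lebesgue_tuple R d]_x (psi x)%:E = 1)%E ->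
  (forall x, (1 - eps%:num) * `|gauss_mix_pdf nu0 x - gauss_mix_pdf nu1 x| <=
     2 * eps%:num * psi x) ->
  exists Q0 Q1 : probability (d.-tuple R) R, forall A, measurable A ->
    contaminate eps (gauss_mix nu0) Q0 A = contaminate eps (gauss_mix nu1) Q1 A.
Proof.
move=> e0 mpsi psi1 dom.
have e1 : eps%:num <= 1 by [].
set e := eps%:num in e0 e1 dom *.
pose c := (1 - e) / (2 * e).
have c0 : 0 <= c by rewrite divr_ge0 ?subr_ge0// mulr_ge0// ltW.
have ec : 2 * e * c = 1 - e by rewrite /c; field; rewrite gt_eqF.
have e20 : 0 < 2 * e by rewrite mulr_gt0.
pose q (nu nu' : probability (d.-tuple R) R) x :=
  psi x + c * (gauss_mix_pdf nu' x - gauss_mix_pdf nu x).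
have mq nu nu' : measurable_fun setT (q nu nu').
  apply: measurable_funD => //; apply: measurable_funM => //.
  by apply: measurable_funB; exact: measurable_gauss_mix_pdf.
have q_ge0 nu nu' :
    (forall x, (1 - e) * `|gauss_mix_pdf nu' x - gauss_mix_pdf nu x| <=
      2 * e * psi x) -> forall x, 0 <= q nu nu' x.
  move=> h x; rewrite -(pmulr_rge0 _ e20) /q mulrDr mulrA ec.
  have := h x; rewrite -[X in X * _]ger0_norm ?subr_ge0// -normrM.
  by move/ler_normlP => [? ?]; lra.
have mE nu : measurable_fun setT (fun x => (@gauss_mix_pdf R d nu x)%:E).
  by apply/measurable_EFinP; exact: measurable_gauss_mix_pdf.
have q1 nu nu' : (forall x, 0 <= q nu nu' x) ->
    (\int[lebesgue_tuple R d]_x (q nu nu' x)%:E = 1)%E.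
  move=> qp.
  have psi0 x : 0 <= psi x.
    rewrite -(pmulr_rge0 _ e20); apply: le_trans (dom x).
    by rewrite mulr_ge0// subr_ge0.
  have I nu2 : (\int[lebesgue_tuple R d]_x (c%:E * (gauss_mix_pdf nu2 x)%:E) = c%:E)%E.
    rewrite ge0_integralZl_EFin ?integral_gauss_mix_pdf ?mule1//.
    by move=> x _; rewrite lee_fin gauss_mix_pdf_ge0.
  (* Adding [c] times the subtracted density to both sides keeps the integrands nonnegative, so the
     integral is additive; the finite [c] is cancelled afterwards. *)
  have : (\int[lebesgue_tuple R d]_x ((q nu nu' x)%:E + c%:E * (gauss_mix_pdf nu x)%:E) =
      \int[lebesgue_tuple R d]_x ((psi x)%:E + c%:E * (gauss_mix_pdf nu' x)%:E))%E.
    by apply: eq_integral => x _; rewrite -!EFinM -!EFinD /q; congr EFin; ring.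
  have p0 nu2 x : setT x -> (0 <= c%:E * (gauss_mix_pdf nu2 x)%:E)%E.
    by move=> _; rewrite lee_fin mulr_ge0// gauss_mix_pdf_ge0.
  have mp nu2 : measurable_fun setT (fun x => c%:E * (@gauss_mix_pdf R d nu2 x)%:E)%E.
    by apply: emeasurable_funM.
  rewrite !ge0_integralD//; try exact/measurable_EFinP; try exact: p0;
    try by move=> x _; rewrite lee_fin.
  rewrite !I psi1.
  case: (\int[_]_x _)%E => //= r; rewrite -!EFinD => -[]/addIr ->.
  by [].
have dom' x : (1 - e) * `|gauss_mix_pdf nu1 x - gauss_mix_pdf nu0 x| <= 2 * e * psi x.
  by rewrite distrC.
have q01 := q_ge0 _ _ dom'; have q10 := q_ge0 _ _ dom.
have [Q0 Q0E] := probability_of_density _ _ _ _ _ (mq nu0 nu1) q01 (q1 _ _ q01).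
have [Q1 Q1E] := probability_of_density _ _ _ _ _ (mq nu1 nu0) q10 (q1 _ _ q10).
exists Q0, Q1 => A mA; rewrite !contaminateE /= Q0E Q1E /gauss_mix -/e.
have comb nu nu' : (forall x, 0 <= q nu nu' x) ->
  ((1 - e)%:E * \int[lebesgue_tuple R d]_(x in A) (gauss_mix_pdf nu x)%:E +
   e%:E * \int[lebesgue_tuple R d]_(x in A) (q nu nu' x)%:E =
   \int[lebesgue_tuple R d]_(x in A) ((1 - e) * gauss_mix_pdf nu x + e * q nu nu' x)%:E)%E.
  move=> qp; under [RHS]eq_integral do rewrite EFinD EFinM EFinM.
  have mE' : measurable_fun A (fun x => (gauss_mix_pdf nu x)%:E).
    exact: measurable_funTS.
  have mq' : measurable_fun A (fun x => (q nu nu' x)%:E).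
    by apply: measurable_funTS; exact/measurable_EFinP.
  rewrite ge0_integralD//; first last.
  - by apply: emeasurable_funM.
  - by move=> x _; rewrite mule_ge0// lee_fin// ltW.
  - by apply: emeasurable_funM.
  - by move=> x _; rewrite mule_ge0// lee_fin ?subr_ge0 ?gauss_mix_pdf_ge0.
  rewrite !ge0_integralZl_EFin ?subr_ge0// ?(ltW e0)//.
    by move=> x _; rewrite lee_fin.
  by move=> x _; rewrite lee_fin gauss_mix_pdf_ge0.
(* Both contaminated densities equal [e psi + (1 - e) (f0 + f1) / 2]. *)
rewrite !comb//; apply: eq_integral => x _; congr EFin.
by rewrite /q -ec; ring.
Qed.

(* For [p = q = 0] the left-hand side is [0 / 0 = 0]. *)
Lemma sqr_sqrtB_ge (R : realType) (p q : R) : 0 <= p -> 0 <= q ->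
  (p - q) ^+ 2 / (2 * (p + q)) <= (Num.sqrt p - Num.sqrt q) ^+ 2.
Proof.
move=> p0 q0; rewrite -{1 2}(sqr_sqrtr p0) -{1 2}(sqr_sqrtr q0).
move: (Num.sqrt p) (Num.sqrt q) => x y.
have [xy0|xy0] := eqVneq (x ^+ 2 + y ^+ 2) 0.
  by rewrite xy0 mulr0 invr0 mulr0 sqr_ge0.
have xy : 0 < 2 * (x ^+ 2 + y ^+ 2).
  by rewrite mulr_gt0// lt0r xy0 addr_ge0 ?sqr_ge0.
rewrite ler_pdivrMr// subr_sqr exprMn ler_wpM2l ?sqr_ge0//.
by have := sqr_ge0 (x - y); rewrite sqrrB sqrrD; lra.
Qed.

(** The bound on [t] lets the envelope absorb the difference of the densities. In the conclusion,
    [4^-1] comes from the two-point reduction, [2^-1] from the Hellinger distance and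
    [exp(- M^2 / 2)] from the normalizing constant of the mixtures. *)
Lemma minimax_risk_ge (R : realType) (d n k : nat) (M t : R) (eps : {i01 R}) :
  0 < M -> odd k -> 0 <= t <= 1 -> 0 < eps%:num ->
  t * (4 * expR (16 * M ^+ 2) * Num.sqrt (upper_rate M k)) <= eps%:num ->
  ((4^-1 * (2^-1 * (t ^+ 2 * expR (- (M ^+ 2 / 2)) * lower_rate M k)))%:E <=
     minimax_risk d.+1 n M eps)%E.
Proof.
move=> M0 kodd /andP[t0 t1] e0 teps.
have k0 : (0 < k)%N by case: k kodd {teps}.
have [c [ec c1 nus]] := binomial_mixtures R M k M0 kodd d.
have nt : `|t| <= 1 by rewrite ger0_norm.
have nnt : `|- t| <= 1 by rewrite normrN.
have [nu0 [s0 nu0E]] := nus _ nt; have [nu1 [s1 nu1E]] := nus _ nnt.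
pose a := M / k%:R.
have c0 : 0 <= c by apply: le_trans ec; exact: expR_ge0.
have upper x := normal_pdf_hsinh_le M a k M0 k0 (erefl _) x.
have lower x := normal_pdf_hsinh_ge M a k M0 k0 (erefl _) x.
have phi0 (y : R) : 0 <= normal_pdf 0 1 y by exact: normal_pdf_ge0.
have mcoord : measurable_fun setT (fun x : d.+1.-tuple R => tnth x ord0).
  exact: measurable_tnth.
have [Q0 [Q1 QE]] : exists Q0 Q1 : probability (d.+1.-tuple R) R,
    forall A, measurable A -> contaminate eps (gauss_mix nu0) Q0 A =
      contaminate eps (gauss_mix nu1) Q1 A.
  apply: (contaminations_agree _ _ _ _ _
    (fun x => tail_pdf x * normal_pdf 0 4 (tnth x ord0))) => //.
  - apply: measurable_funM; first exact: measurable_tail_pdf.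
    exact: (measurableT_comp (measurable_normal_pdf 0 4) mcoord).
  - apply: integral_tail_pdf; first exact: measurable_normal_pdf.
      by move=> y; exact: normal_pdf_ge0.
    rewrite ge0_integral_lebesgue_real ?integral_normal_pdf//.
      by apply/measurable_EFinP; exact: measurable_normal_pdf.
    by move=> y; rewrite lee_fin normal_pdf_ge0.
  - move=> x; rewrite nu0E nu1E -/a; set y := tnth x ord0.
    have w0 := @tail_pdf_ge0 R d x.
    set w := tail_pdf x in w0 *; set phi := normal_pdf 0 1 y.
    set S := hsinh _ ^+ k; set C := hcosh _ ^+ k.
    rewrite [X in `|X|](_ : _ = 2 * (t * (w * (phi * c * S)))); last by ring.
    rewrite 5!normrM (ger0_norm t0) (ger0_norm w0) (ger0_norm c0).
    rewrite (ger0_norm (phi0 y)) (ger0_norm (ler0n R 2)) -(mulrA 2) mulrCA ler_wpM2l//.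
    have S0 : 0 <= `|S| by [].
    apply: (@le_trans _ _ (t * (w * (phi * `|S|)))).
      rewrite -[leRHS]mul1r ler_pM ?subr_ge0 ?mulr_ge0 ?phi0//.
      by rewrite 2?ler_wpM2l// ler_wpM2r// ler_piMr ?phi0.
    rewrite mulrCA [leRHS]mulrCA ler_wpM2l//.
    apply: le_trans (ler_wpM2r _ teps); last exact: normal_pdf_ge0.
    rewrite -[leRHS]mulrA ler_wpM2l// /S normrX; exact: upper.
apply: (minimax_risk_two_points _ _ _ _ _ _ _ _ _ _ s0 s1 QE).
rewrite sqr_hellinger EFinM lee_wpmul2l ?lee_fin ?invr_ge0//.
have L0 : 0 <= lower_rate M k by exact/ltW/lower_rate_gt0.
set K := t ^+ 2 * _ * _.
have K0 : 0 <= K.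
  by apply: mulr_ge0 => //; rewrite mulr_ge0 ?sqr_ge0 ?expR_ge0.
set r := Num.sqrt (2 * k%:R : R) in lower *.
(* Only the slab with first coordinate in [I] is kept. Its indicator times [tail_pdf] has integral
   one, so a pointwise bound by [K] integrates to [K]. *)
pose I : set R := `[r, r + 1]%classic.
have mI1 : measurable_fun setT (\1_I : R -> R).
  by apply: measurable_indic; exact: measurable_itv.
have I1 : (\int[lebesgue_tuple R d.+1]_x
    (tail_pdf x * \1_I (tnth x ord0))%:E = 1)%E.
  apply: integral_tail_pdf => //.
  rewrite ge0_integral_lebesgue_real//.
    rewrite integral_indic//; last exact: measurable_itv.
    rewrite setIT /I.
    by rewrite [LHS](lebesgue_measure_itv `[r, r + 1])/= lte_fin ltrDl ltr01 -EFinB addrC addKr.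
  exact/measurable_EFinP.
have mI : measurable_fun setT (fun x : d.+1.-tuple R =>
    (tail_pdf x * \1_I (tnth x ord0))%:E).
  apply/measurable_EFinP; apply: measurable_funM; first exact: measurable_tail_pdf.
  exact: (measurableT_comp mI1 mcoord).
have I0 (x : d.+1.-tuple R) : (0 <= (tail_pdf x * \1_I (tnth x ord0))%:E)%E.
  by rewrite lee_fin mulr_ge0// tail_pdf_ge0.
rewrite -[leLHS]mule1 -I1 -ge0_integralZl_EFin//.
apply: ge0_le_integral => //.
- by move=> x _; rewrite mule_ge0.
- exact: emeasurable_funM.
- apply/measurable_EFinP; apply: measurable_funX.
  by apply: measurable_funB; apply: measurableT_comp;
    [exact: measurable_sqrt|exact: measurable_gauss_mix_pdf|
     exact: measurable_sqrt|exact: measurable_gauss_mix_pdf].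
move=> x _; rewrite -EFinM lee_fin indicE.
have [yI|_] := boolP (tnth x ord0 \in I); last by rewrite !mulr0 sqr_ge0.
rewrite mulr1; apply: le_trans (sqr_sqrtB_ge _ _ _ _ _); last 2 first.
- exact: gauss_mix_pdf_ge0.
- exact: gauss_mix_pdf_ge0.
have {yI} : r <= tnth x ord0 <= r + 1 by move: yI; rewrite inE /I/= in_itv.
move=> /lower; rewrite nu0E nu1E -/a; set y := tnth x ord0.
have w0 := @tail_pdf_ge0 R d x.
set w := tail_pdf x in w0 *; set phi := normal_pdf 0 1 y.
set S := hsinh _ ^+ k; set C := hcosh _ ^+ k.
have C0 : 0 < C by rewrite exprn_gt0// hcosh_gt0.
move=> low.
(* With [b = w phi c], the difference is [2 b t S] and the sum is [2 b C]; if [b = 0], both sides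
   vanish by the convention on division by zero. *)
have -> : (w * phi * c * (C + t * S) - w * phi * c * (C + - t * S)) ^+ 2 /
    (2 * (w * phi * c * (C + t * S) + w * phi * c * (C + - t * S))) =
    t ^+ 2 * c * (phi * S ^+ 2 / C) * w.
  transitivity (w * phi * c * (t ^+ 2 * S ^+ 2 / C)); last by ring.
  move: (w * phi * c) => b.
  have [->|b0] := eqVneq b 0; first by rewrite !mul0r subrr expr0n mul0r.
  rewrite (_ : b * (C + t * S) - _ = 2 * b * t * S); last by ring.
  rewrite (_ : b * (C + t * S) + _ = 2 * b * C); last by ring.
  by field; rewrite b0 gt_eqF.
rewrite /K ler_wpM2r//; apply: ler_pM => //.
  by rewrite mulr_ge0 ?sqr_ge0 ?expR_ge0.
by rewrite ler_wpM2l ?sqr_ge0.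
Qed.

(** * Choice of [k] and the resulting gain *)

Section rate_asymptotics.
Context {R : realType} (M : R).
Hypothesis M0 : 0 < M.

(** The ratio of the bases of [lower_rate] and [upper_rate] is [29 / 16]. The bound follows from
    [exp(- 1 / 8) >= 7 / 8] and [(8 / 7)^4 <= 29 / 16]. *)
Lemma expR_half_le : expR 2^-1 <= 29 / 16 :> R.
Proof.
have e8 : expR (- 8^-1) >= 7 / 8 :> R by have := expR_ge1Dx (- 8^-1 : R); lra.
have -> : 2^-1 = - (4%:R * - 8^-1) :> R by field.
rewrite expRN expRM_natl.
have h : (7 / 8) ^+ 4 <= expR (- 8^-1) ^+ 4 :> R.
  by rewrite lerXn2r ?nnegrE ?expR_ge0.
apply: (@le_trans _ _ ((7 / 8) ^+ 4)^-1).
  by rewrite lef_pV2 ?posrE ?exprn_gt0 ?expR_gt0.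
by rewrite invf_ple ?posrE ?exprn_gt0//; lra.
Qed.

Let C1 : R := normal_peak 1 * expR (- (2^-1 + 3 * M)) *
  expR (- (20 * (3 * M + 1) ^+ 2)).

Let C1_gt0 : 0 < C1.
Proof. by rewrite !mulr_gt0 ?expR_gt0 ?normal_peak_gt0 ?oner_neq0. Qed.

(** The ratio of the rates contains [(29 / 16)^k >= exp(k / 2)]. The factor in [sqrt(2 k)] costs at
    most [k / 40 + 20 (3 M + 1)^2] in the exponent, which leaves [19 / 40] and the constant in
    [C1]. *)
Lemma lower_rate_ge (k : nat) : (0 < k)%N ->
  C1 * expR (19 / 40 * k%:R) * upper_rate M k <= lower_rate M k.
Proof.
move=> k0; have kR0 : 0 < k%:R :> R by rewrite ltr0n.
have -> : lower_rate M k = normal_peak 1 * expR (- (2^-1 + 3 * M)) *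
    ((29 / 16) ^+ k * expR (- ((3 * M + 1) * Num.sqrt (2 * k%:R)))) * upper_rate M k.
  rewrite /lower_rate /upper_rate.
  have -> : 2 * M ^+ 2 / k%:R * expR (- 1) =
      29 / 16 * (32 * M ^+ 2 / (29 * k%:R) * expR (- 1)).
    by field; rewrite gt_eqF.
  by rewrite (exprMn _ (29 / 16)); ring.
rewrite ler_wpM2r ?(ltW (upper_rate_gt0 _ _ _ _))//.
rewrite /C1 -[leLHS]mulrA ler_wpM2l// ?mulr_ge0 ?expR_ge0 ?normal_peak_ge0//.
apply: (@le_trans _ _ (expR 2^-1 ^+ k * expR (- ((3 * M + 1) * Num.sqrt (2 * k%:R))))).
  rewrite -expRM_natl -!expRD ler_expR.
  have r2 : Num.sqrt (2 * k%:R) ^+ 2 = 2 * k%:R :> R.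
    by rewrite sqr_sqrtr// mulr_ge0// ltW.
  move: r2; set r := Num.sqrt _ => r2.
  have := sqr_ge0 (r - 40 * (3 * M + 1)); rewrite sqrrB r2.
  by move: (3 * M + 1) => B; lra.
rewrite ler_wpM2r ?expR_ge0// lerXn2r ?nnegrE ?expR_ge0//.
exact: expR_half_le.
Qed.

(** With [eps = exp(- L)], this ensures that [t], of order [eps / sqrt(upper_rate)], is at most
    1. *)
Lemma upper_rate_ge (k : nat) (L : R) : (0 < k)%N ->
  k%:R * (ln k%:R + (1 - ln (32 * M ^+ 2 / 29))) <= 2 * L ->
  expR (- L) <= Num.sqrt (upper_rate M k).
Proof.
move=> k0 kL; have kR0 : 0 < k%:R :> R by rewrite ltr0n.
rewrite -[leLHS]ger0_norm ?expR_ge0// -sqrtr_sqr ler_sqrt; last first.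
  by apply/ltW/upper_rate_gt0.
rewrite -expRM_natl /upper_rate.
have q0 : 0 < 32 * M ^+ 2 / 29 by rewrite divr_gt0// mulr_gt0// exprn_gt0.
have -> : 32 * M ^+ 2 / (29 * k%:R) = expR (ln (32 * M ^+ 2 / 29) - ln k%:R).
  by rewrite expRB !lnK ?posrE//; field; rewrite gt_eqF.
by rewrite -expRD -expRM_natl ler_expR; lra.
Qed.

(** This [k] is within 1 of [36 y / 25]. With [y = L / ln L], the lower end yields the gain, as
    [7 / 5 * 19 / 40 > 33 / 50], and the upper end keeps [k ln k] below [2 L] with room for
    lower-order terms. *)
Lemma odd_near (y : R) : 25 <= y ->
  exists k : nat, [/\ odd k, 7 / 5 * y <= k%:R & k%:R <= 3 / 2 * y].
Proof.
move=> y25; exists (Num.truncn (18 / 25 * y)).*2.+1.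
have /truncn_itv : 0 <= 18 / 25 * y by lra.
move: (Num.truncn _) => m; rewrite -[m.+1%:R]natr1 => /andP[m1 m2].
have mE : m.*2.+1%:R = m%:R * 2 + 1 :> R by rewrite -[LHS]natr1 -muln2 natrM.
by split; [rewrite /= odd_double|rewrite mE; lra..].
Qed.

Lemma ln_le_sqrt (L : R) : 0 < L -> ln L <= 2 * Num.sqrt L.
Proof.
move=> L0; have s0 : 0 < Num.sqrt L by rewrite sqrtr_gt0.
rewrite -{1}(sqr_sqrtr (ltW L0)) lnXn// mulr2n.
by have := ln_sublinear s0; lra.
Qed.

Lemma large_log_rate : exists L0 C : R, [/\ 0 < C, expR 1 <= L0 &
  forall L, L0 <= L -> exists k : nat, [/\ odd k,
    expR (- L) <= Num.sqrt (upper_rate M k) &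
    C * expR (33 / 50 * (L / ln L)) * upper_rate M k <= lower_rate M k]].
Proof.
pose D := 1 - ln (32 * M ^+ 2 / 29).
(* The term 2500 gives [sqrt L >= 50], hence [L / ln L >= sqrt L / 2 >= 25]. The exponential gives
   [D <= ln L / 3] and [ln L >= 3 / 2], the latter implying [k <= L]. *)
exists (2500 + expR (3 * `|D| + 3 / 2)), C1; split => //.
  have : expR 1 <= expR (3 * `|D| + 3 / 2).
    by rewrite ler_expR; have := normr_ge0 D; lra.
  by lra.
move=> L LL0.
have e0 : 0 < expR (3 * `|D| + 3 / 2) by exact: expR_gt0.
have L2500 : 2500 <= L by lra.
have L0 : 0 < L by lra.
have lnL : 3 * `|D| + 3 / 2 <= ln L.
  by rewrite -ler_expR lnK ?posrE//; lra.
have D0 := normr_ge0 D.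
have lnL0 : 0 < ln L by lra.
have y25 : 25 <= L / ln L.
  rewrite ler_pdivlMr//.
  have s50 : 50 <= Num.sqrt L.
    by rewrite -[50]ger0_norm// -sqrtr_sqr ler_sqrt ?(ltW L0)//; lra.
  apply: (@le_trans _ _ (Num.sqrt L * Num.sqrt L)); last first.
    by rewrite -expr2 sqr_sqrtr ?(ltW L0).
  apply: (@le_trans _ _ (25 * (2 * Num.sqrt L))).
    by rewrite ler_wpM2l//; exact: ln_le_sqrt.
  by rewrite mulrA ler_wpM2r ?sqrtr_ge0//; lra.
have [k [kodd yk ky]] := odd_near _ y25.
have k0 : (0 < k)%N by case: k kodd {yk ky}.
have kR0 : 0 < k%:R :> R by rewrite ltr0n.
have yL : L / ln L * ln L = L by rewrite divfK// gt_eqF.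
exists k; split => //.
- apply: upper_rate_ge => //; rewrite -/D.
  have lnk : ln k%:R <= ln L.
    rewrite ler_ln ?posrE//; apply: le_trans ky _.
    rewrite -[leRHS]yL mulrC ler_wpM2l//; lra.
  apply: (@le_trans _ _ (3 / 2 * (L / ln L) * (4 / 3 * ln L))); last by lra.
  apply: (@le_trans _ _ (k%:R * (4 / 3 * ln L))).
    by rewrite ler_wpM2l ?(ltW kR0)//; have := ler_norm D; lra.
  by rewrite ler_wpM2r// mulr_ge0// ltW.
- apply: le_trans (lower_rate_ge k k0).
  rewrite ler_wpM2r ?(ltW (upper_rate_gt0 _ _ _ _))//.
  by rewrite ler_wpM2l ?(ltW C1_gt0)// ler_expR; lra.
Qed.

End rate_asymptotics.

(** * Choice of [t] and conclusion *)

Theorem theorem4p6 (R : realType) (d : nat) (M : R)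
    (hd : (1 <= d)%N) (hM : 0 < M) :
  exists c : R, 0 < c /\
    forall (n : nat) (eps : {i01 R}),
      (1 <= n)%N -> 0 < eps%:num -> eps%:num < 1 ->
      ((c * eps%:num `^
          (2 * (1 - 33 / 100 /
                      ln (Num.max (ln (1 / eps%:num)) (expR 1)))))%:E
        <= minimax_risk d n M eps)%E.
Proof.
case: d hd => [//|d] _.
have [L0 [C [C0 eL0 rate]]] := large_log_rate M hM.
pose A : R := 4 * expR (16 * M ^+ 2).
have A1 : 1 <= A.
  have : 1 <= expR (16 * M ^+ 2) by rewrite -expR0 ler_expR mulr_ge0// sqr_ge0.
  by rewrite /A; lra.
have A0 : 0 < A by lra.
pose s1 : R := Num.sqrt (upper_rate M 1).
have s10 : 0 < s1 by rewrite sqrtr_gt0 upper_rate_gt0.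
(* For [L < L0], that is [eps > exp(- L0)], the choice [k = 1] and [t = t1] gives a constant bound;
   the rate is at most 1 there. *)
pose t1 : R := Num.min 1 (expR (- L0) / (A * s1)).
have t10 : 0 < t1 by rewrite lt_min ltr01 divr_gt0 ?expR_gt0// mulr_gt0.
pose G : R := expR (- (M ^+ 2 / 2)).
have G0 : 0 < G by exact: expR_gt0.
pose c1 : R := 4^-1 * (2^-1 * (t1 ^+ 2 * G * lower_rate M 1)).
pose c2 : R := 4^-1 * (2^-1 * (G * C / A ^+ 2)).
have c10 : 0 < c1.
  apply: mulr_gt0 => //; apply: mulr_gt0 => //.
  by rewrite mulr_gt0 ?lower_rate_gt0// mulr_gt0// exprn_gt0.
have c20 : 0 < c2.
  by apply: mulr_gt0 => //; apply: mulr_gt0 => //; rewrite divr_gt0 ?exprn_gt0// mulr_gt0.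
exists (Num.min c1 c2); split; first by rewrite lt_min c10.
move=> n eps _ e0 e1; set e := eps%:num in e0 e1 *.
pose L := ln (1 / e).
have lne : ln e = - L by rewrite /L div1r lnV// opprK.
have Lgt0 : 0 < L by rewrite -oppr_lt0 -lne ln_lt0// e0.
have eE : e = expR (- L) by rewrite -lne lnK.
rewrite /powR gt_eqF// lne -/L.
have lnmax : 1 <= ln (Num.max L (expR 1)).
  by rewrite -[leLHS]expRK ler_ln ?posrE ?expR_gt0 ?lt_max ?Lgt0// le_max lexx orbT.
have [LL0|LL0] := leP L0 L; last first.
  apply: (@le_trans _ _ c1%:E).
    rewrite lee_fin -[leRHS]mulr1 ler_pM ?expR_ge0 ?le_min ?(ltW c10) ?(ltW c20)//.
      by rewrite ge_min lexx.
    rewrite -[leRHS]expR0 ler_expR mulrN oppr_le0 mulr_ge0 ?(ltW Lgt0)// mulr_ge0//.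
    rewrite subr_ge0 ler_pdivrMr ?(lt_le_trans ltr01 lnmax)// mul1r.
    by apply: le_trans lnmax; lra.
  apply: minimax_risk_ge => //; first by rewrite (ltW t10) ge_min lexx.
  apply: (@le_trans _ _ (expR (- L0))); last by rewrite -/e eE ler_expR lerN2 ltW.
  rewrite -/A -/s1 -ler_pdivlMr; last exact: mulr_gt0.
  by rewrite ge_min lexx orbT.
have [k [kodd ub lb]] := rate _ LL0.
have k0 : (0 < k)%N by case: k kodd {ub lb}.
have maxL : Num.max L (expR 1) = L by apply/max_idPl/(le_trans eL0).
have lnL : 1 <= ln L by rewrite -[in leRHS]maxL.
set s := Num.sqrt (upper_rate M k) in ub.
have u0 := upper_rate_gt0 M k hM k0.
have s0 : 0 < s by rewrite sqrtr_gt0.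
have As0 : 0 < A * s by exact: mulr_gt0.
have s2 : s ^+ 2 = upper_rate M k by rewrite sqr_sqrtr// ltW.
(* The largest [t] that the contamination can hide; it is at most 1 because [A >= 1] and
   [e <= s]. *)
apply: le_trans (minimax_risk_ge R d n k M (e / (A * s)) eps hM kodd _ e0 _); last 2 first.
- rewrite divr_ge0 ?(ltW e0) ?(ltW As0)//=.
  rewrite ler_pdivrMr// mul1r eE (le_trans ub)//.
  by rewrite -[leLHS]mul1r ler_wpM2r ?(ltW s0).
- by rewrite -/A -/s divfK// gt_eqF.
rewrite maxL lee_fin -/G.
apply: (@le_trans _ _ (c2 * (e ^+ 2 * expR (33 / 50 * (L / ln L))))).
  rewrite ler_pM ?expR_ge0 ?le_min ?(ltW c10) ?(ltW c20)//.
    by rewrite ge_min lexx orbT.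
  (* With [e = exp(- L)], the claimed power of [e] is exactly [e^2 exp(0.66 L / ln L)]. *)
  rewrite eE -expRM_natl -expRD ler_expR le_eqVlt; apply/orP; left; apply/eqP.
  by field; rewrite gt_eqF// (lt_le_trans ltr01).
(* The factor [upper_rate] in the denominator cancels against the one in [lb]. *)
have -> : (e / (A * s)) ^+ 2 = e ^+ 2 / (A ^+ 2 * upper_rate M k).
  by rewrite -s2; field; rewrite !gt_eqF.
rewrite [leLHS](_ : _ = 4^-1 * (2^-1 * (e ^+ 2 / (A ^+ 2 * upper_rate M k) * G *
   (C * expR (33 / 50 * (L / ln L)) * upper_rate M k)))); last first.
  rewrite /c2; field; rewrite !gt_eqF//.
rewrite !ler_wpM2l ?invr_ge0//.
by rewrite mulr_ge0 ?(ltW G0)// divr_ge0 ?sqr_ge0// mulr_ge0 ?sqr_ge0 ?(ltW u0).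
Qed.
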